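(* Consider the system, the multi-observer, the monitoring signals, the selection criterion and the resulting estimates (static sampling policy) described in the context, and suppose Assumptions A1–A5 of the context hold. Then for any $\Delta_{\tilde x},\Delta_x,\Delta_u,\Delta_v,\Delta_w\in\mathbb{R}_{\geqslant 0}$ and any margins $\nu_{\tilde p},\nu_{\tilde x}\in\mathbb{R}_{>0}$, there exist functions $\upsilon_{\tilde p},\upsilon_{\tilde x},\omega_{\tilde p},\omega_{\tilde x}\in\mathcal{K}_\infty$, a constant $K_{\tilde x}\in\mathbb{R}_{>0}$ and sufficiently large integers $N^\star\geqslant 1$ and $M\geqslant 1$ such that for any integer $N\geqslant N^\star$ the following holds for any $\tilde x_{i,0}\in\mathbb{B}^{n_x}_{\Delta_{\tilde x}}$, $i\in\{1,\dots,N\}$, any $p\in\mathbb{P}$, any $x_0\in\mathbb{B}^{n_x}_{\Delta_x}$, any $\{v_k\}_{k\in\mathbb{N}}$ with $v_k\in\mathbb{B}^{n_v}_{\Delta_v}$, any $\{w_k\}_{k\in\mathbb{N}}$ with $w_k\in\mathbb{B}^{n_w}_{\Delta_w}$, and for some input sequence $\{u_k\}_{k\in\mathbb{N}}$ with $u_k\in\mathbb{B}^{n_u}_{\Delta_u}$, $k\in\mathbb{N}$, which satisfies the persistence-of-excitation Assumption A5: $\tilde x_{i,k}\in\mathbb{B}^{n_x}_{K_{\tilde x}}$ for all $k\in\mathbb{N}$ and $i\in\{1,\dots,N\}$, and $$\|\tilde p_{\pi_k}\|\leqslant \nu_{\tilde p}+\upsilon_{\tilde p}(\|\{v_j\}\|)+\omega_{\tilde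 p}(\|\{w_j\}\|)\quad\text{for all integers } k\geqslant M,$$ $$\limsup_{k\to\infty}\|\tilde x_k\|\leqslant \nu_{\tilde x}+\upsilon_{\tilde x}(\|\{v_j\}\|)+\omega_{\tilde x}(\|\{w_j\}\|).$$
   Context: Notation. $\mathbb{N}=\{0,1,\dots\}$; $\|\cdot\|$ is a fixed (arbitrary) $p$-norm on each $\mathbb{R}^n$; $\mathbb{B}^n_r=\{x\in\mathbb{R}^n:\|x\|\leqslant r\}$; for a sequence, $\|\{x_j\}\|=\sup_{j\in\mathbb{N}}\|x_j\|$. $\mathcal{K}$: continuous strictly increasing functions $\alpha:\mathbb{R}_{\geqslant0}\to\mathbb{R}_{\geqslant0}$ with $\alpha(0)=0$; $\mathcal{K}_\infty$: those $\alpha\in\mathcal{K}$ with $\alpha(r)\to\infty$ as $r\to\infty$. System. $x_{k+1}=f(x_k,p,u_k,v_k)$, $y_k=h(x_k,p,u_k,w_k)$, $k\in\mathbb{N}$, with state $x_k\in\mathbb{R}^{n_x}$, input $u_k\in\mathbb{R}^{n_u}$, output $y_k\in\mathbb{R}^{n_y}$, process noise $v_k\in\mathbb{R}^{n_v}$, measurement noise $w_k\in\mathbb{R}^{n_w}$, and given functions $f:\mathbb{R}^{n_x}\times\mathbb{P}\times\mathbb{R}^{n_u}\times\mathbb{R}^{n_v}\to\mathbb{R}^{n_x}$, $h:\mathbb{R}^{n_x}\times\mathbb{P}\times\mathbb{R}^{n_u}\times\mathbb{R}^{n_w}\to\mathbb{R}^{n_y}$, where $h$ is locally Lipschitz continuous.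 The system has a unique solution defined for all $k\in\mathbb{N}$ for all initial conditions, inputs, noises and $p\in\mathbb{P}$. Multi-observer (static sampling). For each integer $N\geqslant1$, samples $\hat p_1,\dots,\hat p_N\in\mathbb{P}$ are chosen so that $\lim_{N\to\infty}\max_{p\in\mathbb{P}}\min_{i\in\{1,\dots,N\}}\|\hat p_i-p\|=0$. For each $i$, the observer is $\hat x_{i,k+1}=\hat f(\hat x_{i,k},\hat p_i,u_k,y_k)$, $\hat y_{i,k}=h(\hat x_{i,k},\hat p_i,u_k,0)$, with $\hat f:\mathbb{R}^{n_x}\times\mathbb{P}\times\mathbb{R}^{n_u}\times\mathbb{R}^{n_y}\to\mathbb{R}^{n_x}$. Errors: $\tilde x_{i,k}=\hat x_{i,k}-x_k$, $\tilde y_{i,k}=\hat y_{i,k}-y_k$, $\tilde p_i=\hat p_i-p$. $\mathbb{D}\subset\mathbb{R}^{n_p}$ is a compact set containing $\hat p-p$ for all $p,\hat p\in\mathbb{P}$. The errors obey the error system $\tilde x_{i,k+1}=F(\tilde x_{i,k},x_k,\tilde p_i,p,u_k,v_k,w_k)$, $\tilde y_{i,k}=H(\tilde x_{i,k},x_k,\tilde p_i,p,u_k,w_k)$, where $F(\tilde x,x,\tilde p,p,u,v,w)=\hat f(\tilde x+x,\tilde p+p,u,h(x,p,u,w))-f(x,p,u,v)$ and $H(\tilde x,x,\tilde p,p,u,w)=h(\tilde x+x,\tilde p+p,u,0)-h(x,p,u,w)$. Whenever $\tilde p\in\mathbb{D}$ appears together with $p\in\mathbb{P}$, it is understood that $\hat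 p=\tilde p+p\in\mathbb{P}$. Supervisor. With a design parameter $\lambda\in[0,1)$, the monitoring signals are $\mu_{i,k}=\sum_{j=0}^{k-1}\lambda^{k-1-j}\|\tilde y_{i,j}\|^2$, $k\in\mathbb{N}$ (so $\mu_{i,0}=0$ and $\mu_{i,k+1}=\lambda\mu_{i,k}+\|\tilde y_{i,k}\|^2$). The selected index satisfies $\pi_k\in\arg\min_{i\in\{1,\dots,N\}}\mu_{i,k}$ (any minimizer may be chosen). Estimates: $\hat p_k=\hat p_{\pi_k}$, $\hat x_k=\hat x_{\pi_k,k}$, $\tilde x_k=\tilde x_{\pi_k,k}$. Assumptions. A1: $u_k,v_k,w_k$ are bounded: there are $\Delta_u,\Delta_v,\Delta_w\geqslant0$ with $u_k\in\mathbb{B}^{n_u}_{\Delta_u}$, $v_k\in\mathbb{B}^{n_v}_{\Delta_v}$, $w_k\in\mathbb{B}^{n_w}_{\Delta_w}$ for all $k\in\mathbb{N}$. A2: the parameter $p$ is constant, unknown and belongs to a given compact set $\mathbb{P}\subset\mathbb{R}^{n_p}$. A3: for all $\Delta_x,\Delta_u,\Delta_v,\Delta_w\geqslant0$ there is $K_x>0$ such that for all $x_0\in\mathbb{B}^{n_x}_{\Delta_x}$ and all sequences with $u_k\in\mathbb{B}^{n_u}_{\Delta_u}$, $v_k\in\mathbb{B}^{n_v}_{\Delta_v}$, $w_k\in\mathbb{B}^{n_w}_{\Delta_w}$, one has $x_k\in\mathbb{B}^{n_x}_{K_x}$ for all $k\in\mathbb{N}$. A4: there exist $\alpha_1,\alpha_2,\alpha_3\in\mathcal{K}_\infty$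 and a continuous $\sigma:\mathbb{D}\times\mathbb{R}^{n_v}\times\mathbb{R}^{n_w}\times\mathbb{R}^{n_x}\times\mathbb{R}^{n_u}\to\mathbb{R}_{\geqslant0}$ with $\sigma(0,0,0,x,u)=0$ for all $x,u$, and a function $V:\mathbb{P}\times\mathbb{R}^{n_x}\to\mathbb{R}_{\geqslant0}$, such that for all $\tilde x,x\in\mathbb{R}^{n_x}$, $p,\hat p\in\mathbb{P}$ (with $\tilde p=\hat p-p$), $u,v,w$: $V(\hat p,\cdot)$ is continuous, $\alpha_1(\|\tilde x\|)\leqslant V(\hat p,\tilde x)\leqslant\alpha_2(\|\tilde x\|)$, and $V(\hat p,\tilde x^+)\leqslant V(\hat p,\tilde x)-\alpha_3(\|\tilde x\|)+\sigma(\tilde p,v,w,x,u)$ for $\tilde x^+=F(\tilde x,x,\tilde p,p,u,v,w)$. A5 (persistence of excitation): for any $\Delta_{\tilde x},\Delta_x,\Delta_u,\Delta_v,\Delta_w\geqslant0$ there exist $\alpha_{\tilde y}\in\mathcal{K}_\infty$ and an integer $N_{\mathrm{pe}}\geqslant1$ such that for all $\tilde p_i\in\mathbb{D}$, $i\in\{1,\dots,N\}$, $\tilde x_{i,0}\in\mathbb{B}^{n_x}_{\Delta_{\tilde x}}$, $p\in\mathbb{P}$, $x_0\in\mathbb{B}^{n_x}_{\Delta_x}$, $\{v_k\}$ with $v_k\in\mathbb{B}^{n_v}_{\Delta_v}$, $\{w_k\}$ with $w_k\in\mathbb{B}^{n_w}_{\Delta_w}$, and for some input sequence $\{u_k\}$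 with $u_k\in\mathbb{B}^{n_u}_{\Delta_u}$, the solutions of the system and the error system satisfy $\sum_{j=k-N_{\mathrm{pe}}}^{k-1}\|\tilde y_{i,j}\|^2\geqslant\alpha_{\tilde y}(\|\tilde p_i\|)$ for all integers $k\geqslant N_{\mathrm{pe}}$. An input sequence ''satisfies A5'' if this inequality holds for the corresponding solutions.
   Formalization: When λ=0, the formal theorem assumes the window N_pe of A5 at the given radii equals 1 (for λ=0 and N_pe≥2 the claim as stated fails: monitoring signals may all vanish infinitely often); the bound K_x in A3 is read as uniform over p∈ℙ. *)

(* Defs.v *)
From HB Require Import structures.
From mathcomp Require Import all_boot all_order all_algebra.
From mathcomp Require Import all_classical all_reals all_analysis.

Set Implicit Arguments.
Unset Strict Implicit.
Unset Printing Implicit Defensive.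

Import Order.TTheory GRing.Theory Num.Theory.
Import numFieldNormedType.Exports.

Local Open Scope classical_set_scope.
Local Open Scope ring_scope.

(* The [q]-norm on R^n, meant for [1 <= q <= +oo].  It is not the library norm
   on matrices, which is the maximum norm; the topologies agree. *)
Definition pnorm (R : realType) (q : \bar R) (n : nat) (x : 'rV[R]_n) : R :=
  if q is r%:E then (\sum_i `|x ord0 i| `^ r) `^ r^-1
  else \big[Num.max/0]_i `|x ord0 i|.

Definition pball (R : realType) (q : \bar R) (n : nat) (r : R) : set 'rV[R]_n :=
  [set x | pnorm q x <= r].
Arguments pball {R} q {n} r.

Definition seq_norm (R : realType) (q : \bar R) (n : nat)
    (x : nat -> 'rV[R]_n) : R :=
  sup [set pnorm q (x j) | j in [set: nat]].

(* Comparison functions are total functions on R of which only the restriction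
   to [0, +oo[ is constrained. *)
Definition class_K (R : realType) (a : R -> R) : Prop :=
  [/\ {within `[0, +oo[%classic, continuous a},
      {in `[0, +oo[ &, {homo a : r s / r < s}} & a 0 = 0].

Definition class_Koo (R : realType) (a : R -> R) : Prop :=
  class_K a /\ a r @[r --> +oo] --> +oo.

(* Functions with an argument in the parameter set [P] are total in that
   argument; their values for parameters outside [P] are never used. *)
Section Dynamics.
Context (R : realType) (nx np nu nv nw ny : nat).
Context (f : 'rV[R]_nx -> 'rV[R]_np -> 'rV[R]_nu -> 'rV[R]_nv -> 'rV[R]_nx).
Context (h : 'rV[R]_nx -> 'rV[R]_np -> 'rV[R]_nu -> 'rV[R]_nw -> 'rV[R]_ny).
Context (fhat : 'rV[R]_nx -> 'rV[R]_np -> 'rV[R]_nu -> 'rV[R]_ny -> 'rV[R]_nx).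

Fixpoint state (p : 'rV[R]_np) (u : nat -> 'rV[R]_nu) (v : nat -> 'rV[R]_nv)
    (x0 : 'rV[R]_nx) (k : nat) : 'rV[R]_nx :=
  if k is k'.+1 then f (state p u v x0 k') p (u k') (v k') else x0.

Fixpoint observer (phat : 'rV[R]_np) (u : nat -> 'rV[R]_nu)
    (y : nat -> 'rV[R]_ny) (xh0 : 'rV[R]_nx) (k : nat) : 'rV[R]_nx :=
  if k is k'.+1 then fhat (observer phat u y xh0 k') phat (u k') (y k') else xh0.

Definition errF (xt x : 'rV[R]_nx) (pt p : 'rV[R]_np)
    (u : 'rV[R]_nu) (v : 'rV[R]_nv) (w : 'rV[R]_nw) : 'rV[R]_nx :=
  fhat (xt + x) (pt + p) u (h x p u w) - f x p u v.

Definition errH (xt x : 'rV[R]_nx) (pt p : 'rV[R]_np)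
    (u : 'rV[R]_nu) (w : 'rV[R]_nw) : 'rV[R]_ny :=
  h (xt + x) (pt + p) u 0 - h x p u w.

Fixpoint err_state (pt p : 'rV[R]_np) (u : nat -> 'rV[R]_nu)
    (v : nat -> 'rV[R]_nv) (w : nat -> 'rV[R]_nw) (x0 xt0 : 'rV[R]_nx)
    (k : nat) : 'rV[R]_nx :=
  if k is k'.+1 then
    errF (err_state pt p u v w x0 xt0 k') (state p u v x0 k') pt p
         (u k') (v k') (w k')
  else xt0.

Definition err_output (pt p : 'rV[R]_np) (u : nat -> 'rV[R]_nu)
    (v : nat -> 'rV[R]_nv) (w : nat -> 'rV[R]_nw) (x0 xt0 : 'rV[R]_nx)
    (k : nat) : 'rV[R]_ny :=
  errH (err_state pt p u v w x0 xt0 k) (state p u v x0 k) pt p (u k) (w k).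

End Dynamics.

Section Supervisor.
Context (R : realType) (q : \bar R).

(* [lambda ^+ 0 = 1] also for [lambda = 0], so that
   [monitor lambda yt k.+1 = lambda * monitor lambda yt k + pnorm q (yt k) ^+ 2]. *)
Definition monitor (ny : nat) (lambda : R) (yt : nat -> 'rV[R]_ny) (k : nat) : R :=
  \sum_(0 <= j < k) lambda ^+ (k - 1 - j) * pnorm q (yt j) ^+ 2.

Definition is_selection (ny N : nat) (lambda : R)
    (yt : 'I_N -> nat -> 'rV[R]_ny) (sel : nat -> 'I_N) : Prop :=
  forall k i, monitor lambda (yt (sel k)) k <= monitor lambda (yt i) k.

(* [P] is compact and the samples lie in [P], so for [0 < N] the [sup] and [inf]
   are the maximum over [P] and the minimum over the [N] samples. *)
Definition samples_dense (np : nat) (P : set 'rV[R]_np)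
    (phat : forall N : nat, 'I_N -> 'rV[R]_np) : Prop :=
  sup [set inf [set pnorm q (phat N i - p) | i in [set: 'I_N]] | p in P]
    @[N --> \oo] --> (0 : R).

Definition excited (np ny N : nat) (al : R -> R) (L : nat)
    (pt : 'I_N -> 'rV[R]_np) (yt : 'I_N -> nat -> 'rV[R]_ny) : Prop :=
  forall i k, (L <= k)%N ->
    al (pnorm q (pt i)) <= \sum_(k - L <= j < k) pnorm q (yt i j) ^+ 2.

End Supervisor.

Section Assumptions.
Context (R : realType) (q : \bar R) (nx np nu nv nw ny : nat).
Context (P D : set 'rV[R]_np).
Context (f : 'rV[R]_nx -> 'rV[R]_np -> 'rV[R]_nu -> 'rV[R]_nv -> 'rV[R]_nx).
Context (h : 'rV[R]_nx -> 'rV[R]_np -> 'rV[R]_nu -> 'rV[R]_nw -> 'rV[R]_ny).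
Context (fhat : 'rV[R]_nx -> 'rV[R]_np -> 'rV[R]_nu -> 'rV[R]_ny -> 'rV[R]_nx).

(* The library asks for a Lipschitz bound near every pair of points of the
   domain.  Near a pair of distinct points such a bound follows from those near
   the diagonal, so this is the usual notion; it does not depend on the norm. *)
Definition locally_lipschitz_output : Prop :=
  [locally [lipschitz h z.1.1.1 z.1.1.2 z.1.2 z.2
           | z in [set z : 'rV[R]_nx * 'rV[R]_np * 'rV[R]_nu * 'rV[R]_nw
                  | P z.1.1.2]]].

(* The bound [Kx] is uniform in the unknown parameter. *)
Definition bounded_states : Prop :=
  forall dx du dv dw : R, 0 <= dx -> 0 <= du -> 0 <= dv -> 0 <= dw ->
  exists2 Kx : R, 0 < Kx &
    forall (p : 'rV[R]_np) (x0 : 'rV[R]_nx) (u : nat -> 'rV[R]_nu)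
           (v : nat -> 'rV[R]_nv) (w : nat -> 'rV[R]_nw),
      P p -> pball q dx x0 ->
      (forall k, pball q du (u k)) -> (forall k, pball q dv (v k)) ->
      (forall k, pball q dw (w k)) ->
      forall k, pball q Kx (state f p u v x0 k).

Definition robust_observer : Prop :=
  exists (a1 a2 a3 : R -> R)
         (sigma : 'rV[R]_np * 'rV[R]_nv * 'rV[R]_nw * 'rV[R]_nx * 'rV[R]_nu -> R)
         (V : 'rV[R]_np -> 'rV[R]_nx -> R),
    [/\ class_Koo a1, class_Koo a2 & class_Koo a3] /\
    [/\ {within [set z | D z.1.1.1.1], continuous sigma},
        forall pt v w x u, D pt -> 0 <= sigma (pt, v, w, x, u)
      & forall x u, sigma (0, 0, 0, x, u) = 0] /\
    [/\ forall ph xt, P ph -> 0 <= V ph xt,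
        forall ph, P ph -> continuous (V ph),
        forall ph xt, P ph -> a1 (pnorm q xt) <= V ph xt <= a2 (pnorm q xt)
      & forall (xt x : 'rV[R]_nx) (p ph : 'rV[R]_np) (u : 'rV[R]_nu)
               (v : 'rV[R]_nv) (w : 'rV[R]_nw),
          P p -> P ph ->
          V ph (errF f h fhat xt x (ph - p) p u v w)
            <= V ph xt - a3 (pnorm q xt) + sigma (ph - p, v, w, x, u)].

(* [al] and [Npe] are the comparison function and the window length as functions
   of the five radii (of the initial estimation errors, the initial state, the
   input, the process noise and the measurement noise).  They do not depend on
   the number [N] of observers, and one input excites all [N] of them. *)
Definition persistently_exciting
    (al : R -> R -> R -> R -> R -> R -> R)
    (Npe : R -> R -> R -> R -> R -> nat) : Prop :=
  forall dxt dx du dv dw : R,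
    0 <= dxt -> 0 <= dx -> 0 <= du -> 0 <= dv -> 0 <= dw ->
  [/\ class_Koo (al dxt dx du dv dw), (1 <= Npe dxt dx du dv dw)%N &
    forall (N : nat) (pt : 'I_N -> 'rV[R]_np) (xt0 : 'I_N -> 'rV[R]_nx)
           (p : 'rV[R]_np) (x0 : 'rV[R]_nx)
           (v : nat -> 'rV[R]_nv) (w : nat -> 'rV[R]_nw),
      (1 <= N)%N -> P p -> (forall i, D (pt i) /\ P (pt i + p)) ->
      (forall i, pball q dxt (xt0 i)) -> pball q dx x0 ->
      (forall k, pball q dv (v k)) -> (forall k, pball q dw (w k)) ->
      exists2 u : nat -> 'rV[R]_nu, forall k, pball q du (u k) &
        excited q (al dxt dx du dv dw) (Npe dxt dx du dv dw) pt
          (fun i => err_output f h fhat (pt i) p u v w x0 (xt0 i))].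

End Assumptions.

Arguments bounded_states {R} q {nx np nu nv} nw P f.

(* Main.v *)
Require Import Defs.
From HB Require Import structures.
From mathcomp Require Import all_boot all_order all_algebra.
From mathcomp Require Import all_classical all_reals all_analysis.
From mathcomp Require Import ring lra zify.

Set Implicit Arguments.
Unset Strict Implicit.
Unset Printing Implicit Defensive.

Import Order.TTheory GRing.Theory Num.Theory.
Import numFieldNormedType.Exports.

Local Open Scope classical_set_scope.
Local Open Scope ring_scope.

(** The margins [nup] and [nux] are fixed before the gains are chosen, so the
    gains only have to separate two regimes, and linear ones do.  Let [d] be a
    noise level to be determined.  The parameter errors lie in the compact set
    [D] and the state errors stay in a fixed ball, so both are bounded a priori;
    with the slope [(Dmax + Kxt) / d], the noise terms of the two bounds exceed
    these a priori bounds as soon as one of the noise sequences is larger than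
    [d].  It remains to show, without any gain, that if both noises stay below
    a small enough [d] then the errors fall below the margins.

    The latter goes backwards along the chain of estimates.
    - The Lyapunov function decreases along the error system up to the term
      [sigma], which is uniformly small when the parameter error and the noises
      are ([disturbance_small]).  Hence an observer whose sample is close to the
      true parameter has a small state error after a time that does not depend
      on the trajectory ([dissipates_eventually_small], [error_eventually_small]).
    - By continuity of [h] its output error is then small, and since the
      monitoring signal forgets the past geometrically, the signal of this
      observer becomes small as well ([monitor_quiet_small]).
    - A sufficiently dense sampling contains such an observer
      ([samples_denseP]).  The selected observer has a monitoring signal that is
      no larger, while persistence of excitation bounds the signal of every
      observer from below by a class-K function of its parameter error.  So the
      selected parameter error is small ([selected_parameter_le]).
    - Once the selected parameter error is small enough, the first step applies
      to the selected observer itself and bounds its state error; the time after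
      which it does so is the same for all observers, so that switching is
      harmless.

    All the uniformity comes from compactness, through the fact that a function
    that is continuous on a set is uniformly continuous near each compact part
    of that set ([uniform_near_compact]). *)

(** * Comparison of the p-norm with the maximum norm *)

Section PNorm.
Context (R : realType) (q : \bar R).

Lemma pnorm_ge0 (n : nat) (x : 'rV[R]_n) : 0 <= pnorm q x.
Proof.
rewrite /pnorm; case: q => [r||]; [exact: powR_ge0| |].
all: by elim/big_ind: _ => // a b a0 b0; rewrite le_max a0.
Qed.

Hypothesis q_ge1 : (1 <= q)%E.

Lemma normr_le_pnorm (n : nat) (x : 'rV[R]_n) : `|x| <= pnorm q x.
Proof.
rewrite [`|x|]mx_normrE; apply: bigmax_le => [|[i j] _ /=]; first exact: pnorm_ge0.
rewrite (ord1 i) /pnorm.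
case: q q_ge1 => [r||//] => [r1 | _]; last exact: le_bigmax.
rewrite lee_fin in r1; have r0 : 0 < r by exact: lt_le_trans r1.
have -> : `|x ord0 j| = (`|x ord0 j| `^ r) `^ r^-1.
  by rewrite -powRrM mulfV ?gt_eqF// powRr1.
apply: ge0_ler_powR; rewrite ?nnegrE ?invr_ge0 ?(ltW r0) ?powR_ge0//.
  by apply: sumr_ge0 => i' _; exact: powR_ge0.
by rewrite (bigD1 j)//= lerDl; apply: sumr_ge0 => i' _; exact: powR_ge0.
Qed.

(** The sharp constant [n `^ r^-1] depends on the exponent; [n.+1] serves for
    all exponents at once, and for [n = 0]. *)
Lemma pnorm_le_normr (n : nat) (x : 'rV[R]_n) : pnorm q x <= n.+1%:R * `|x|.
Proof.
have xj j : `|x ord0 j| <= `|x|.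
  rewrite [`|x|]mx_normrE.
  exact: (le_bigmax _ (fun ij : 'I_1 * 'I_n => `|x ij.1 ij.2|) (ord0, j)).
have n1 : 1 <= n.+1%:R :> R by rewrite ler1n.
rewrite /pnorm; case: q q_ge1 => [r||//] => [r1 | _]; last first.
  apply: bigmax_le => [|j _]; first by rewrite mulr_ge0.
  by apply: le_trans (xj j) _; rewrite ler_peMl.
rewrite lee_fin in r1; have r0 : 0 < r by exact: lt_le_trans r1.
have {1}-> : `|x| = (`|x| `^ r) `^ r^-1.
  by rewrite -powRrM mulfV ?gt_eqF// powRr1.
apply: (@le_trans _ _ ((n.+1%:R * `|x| `^ r) `^ r^-1)).
  apply: ge0_ler_powR; rewrite ?nnegrE ?invr_ge0 ?(ltW r0)//.
  - by apply: sumr_ge0 => i' _; exact: powR_ge0.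
  apply: (@le_trans _ _ (\sum_(i < n) `|x| `^ r)).
    apply: ler_sum => i _; apply: ge0_ler_powR; rewrite ?nnegrE//.
    exact: ltW.
  rewrite sumr_const card_ord -[leLHS]mulr_natl ler_wpM2r ?powR_ge0//.
  by rewrite ler_nat.
rewrite powRM ?powR_ge0// ler_wpM2r ?powR_ge0//.
by apply: ler1_powR; rewrite ?invf_le1.
Qed.

End PNorm.

(** * Uniform estimates from compactness *)

Lemma ball_pair (R : numDomainType) (T U : pseudoMetricType R) (x x' : T)
    (y y' : U) (e : R) :
  ball x e x' -> ball y e y' -> ball (x, y) e (x', y').
Proof. by []. Qed.

(** Only one of the two points ranges over the compact set; the other one is
    any nearby point of [A].  Thus a continuous function that is known where the
    noises and the parameter error vanish is controlled where they are small.
    A near-covering argument, with the radius as the auxiliary parameter, makes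
    the radius uniform. *)
Lemma uniform_near_compact (R : realType) (T U : pseudoMetricType R)
    (A K : set T) (g : T -> U) :
  compact K -> K `<=` A -> {within A, continuous g} ->
  forall e : R, 0 < e -> exists2 d : R, 0 < d &
    forall z0 z, K z0 -> A z -> ball z0 d z -> ball (g z0) e (g z).
Proof.
move=> cK KA /subspace_continuousP cg e e0.
have /(_ R 0^'+ (fun d z0 => forall z, A z -> ball z0 d z -> ball (g z0) e (g z)))
    := (near_covering_withinP K).2 ((compact_near_coveringP K).1 cK).
case=> [x Kx|d d0 /= good].
  have Ax := KA _ Kx.
  have /nbhs_ballP[r /= r0 rP] : within A (nbhs x) (g @^-1` ball (g x) (e / 2)).
    by apply: cg => //; apply: nbhsx_ballx; rewrite divr_gt0.
  have r2 : 0 < r / 2 by rewrite divr_gt0.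
  exists (ball x (r / 2), [set d | d < r / 2]) => /=.
    split; first exact: nbhsx_ballx.
    by apply: nbhs_right_lt.
  move=> [z0 d] /= [xz0 dr] Kz0 z Az z0z.
  apply: (@ball_split _ _ (g x)); first last.
    apply: rP => //; rewrite (splitr r).
    apply: (ball_triangle xz0); apply: le_ball z0z; exact: ltW.
  apply: ball_sym; apply: rP; last exact: KA.
  by apply: le_ball xz0; rewrite ler_pdivrMr// ler_peMr ?ltW// ltr1n.
have d20 : 0 < d / 2 by rewrite divr_gt0.
exists (d / 2) => // z0 z Kz0 Az z0z.
apply: (good (d / 2)) => //=.
  by rewrite /ball_ /= sub0r normrN gtr0_norm// ltr_pdivrMr// ltr_pMr// ltr1n.
Qed.

Lemma compact_normr_le (R : realType) (n : nat) (r : R) :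
  compact [set x : 'rV[R]_n | `|x| <= r].
Proof.
apply: bounded_closed_compact.
  by exists r; split; [exact: num_real|move=> s /= rs x /le_trans -> //; exact: ltW].
rewrite (_ : [set _ | _] = (fun x : 'rV[R]_n => `|x|) @^-1` [set y : R | y <= r]) //.
apply: preimage_closed; last exact: closed_le.
by move=> x _; exact: norm_continuous.
Qed.

(** The Lipschitz condition is a condition near pairs of points; it is used at
    the diagonal pair [(x, x)]. *)
Lemma lipschitz_within_continuous (R : realType) (V W : normedModType R)
    (A : set V) (g : V -> W) :
  [locally [lipschitz g x | x in A]] -> {within A, continuous g}.
Proof.
move=> lip; apply/subspace_continuousP => x Ax.
have [M [_ /(_ (`|M| + 1))]] := lip (x, x) (conj Ax Ax).
have Mlt : M < `|M| + 1 by rewrite (le_lt_trans (ler_norm M))// ltrDl.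
move=> /(_ Mlt); rewrite /dominated_by /=.
set k := `|M| + 1; have k0 : 0 < k by rewrite ltr_wpDl.
move=> /= [[B C] /= [nB nC] BC].
apply/cvgrPdist_lt => e e0; near=> y.
have Ay : A y by near: y; exact: withinT.
have By : B x := nbhs_singleton nB.
have Cy : C y by near: y; apply: cvg_within.
have := BC (x, y) (conj By Cy) (conj Ax Ay) => /= /le_lt_trans; apply.
rewrite mulrC -ltr_pdivlMr//.
near: y; apply: cvg_within.
have ek : 0 < e / k by rewrite divr_gt0.
by move: (nbhsx_ballx x _ ek); rewrite -ball_normE.
Unshelve. all: by end_near. Qed.

(** * Comparison functions *)

Lemma class_Koo_unbounded (R : realType) (a : R -> R) (M : R) :
  class_Koo a -> exists2 r : R, 0 < r & M < a r.
Proof.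
case=> _ /cvgryPgt /(_ M) [B [_ BM]].
have B0 := ltr_pwDl ltr01 (normr_ge0 B).
exists (1 + `|B|) => //; apply: BM.
by rewrite (le_lt_trans (ler_norm B))// ltrDr.
Qed.

Lemma class_K_le (R : realType) (a : R -> R) (r s : R) :
  class_K a -> 0 <= r -> 0 <= s -> (a r <= a s) = (r <= s).
Proof.
case=> _ mono _ r0 s0.
have I x : 0 <= x -> x \in `[0, +oo[ by move=> ?; rewrite in_itv/= andbT.
have [rs|sr] := leP r s; last by apply/negbTE; rewrite -ltNge mono ?I.
move: rs; rewrite le_eqVlt => /predU1P[->|rs]; first exact: lexx.
by apply/ltW/mono; rewrite ?I.
Qed.

Lemma class_K_gt0 (R : realType) (a : R -> R) (r : R) :
  class_K a -> 0 < r -> 0 < a r.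
Proof.
move=> aK r0; have [_ _ a0] := aK.
by rewrite -a0 ltNge class_K_le ?(ltW r0)// -ltNge.
Qed.

Lemma class_K_ge0 (R : realType) (a : R -> R) (r : R) :
  class_K a -> 0 <= r -> 0 <= a r.
Proof. by move=> aK r0; have [_ _ a0] := aK; rewrite -a0 class_K_le. Qed.

Lemma class_K_small (R : realType) (a : R -> R) (e : R) :
  class_K a -> 0 < e -> exists2 r : R, 0 < r & a r < e.
Proof.
move=> [/continuous_within_itvcyP[_ a_right] _ a0] e0.
have /cvgrPdist_lt /(_ e e0) ne := a_right.
near (0 : R)^'+ => r; exists r; first by near: r; exact: nbhs_right_gt.
have : `|a 0 - a r| < e by near: r.
by rewrite a0 sub0r normrN; apply: le_lt_trans; exact: ler_norm.
Unshelve. all: by end_near. Qed.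

Lemma class_Koo_linear (R : realType) (c : R) :
  0 < c -> class_Koo (fun r => c * r).
Proof.
move=> c0; split; first split.
- by apply: continuous_subspaceT => x; apply: mulrl_continuous.
- by move=> r s _ _ rs; rewrite ltr_pM2l.
- by rewrite mulr0.
apply: gt0_cvgMry => //; exact: cvg_id.
Qed.

(** * Dissipation inequalities for real sequences *)

Section Dissipation.
Context (R : realType) (a1 a2 a3 : R -> R).
Hypotheses (a1_Koo : class_Koo a1) (a2_Koo : class_Koo a2) (a3_Koo : class_Koo a3).

(** [e] stands for the size of the error, [W] for the Lyapunov function along
    the trajectory and [s] for a uniform bound on the disturbance. *)
Definition dissipates (s d : R) (e W : nat -> R) : Prop :=
  [/\ e 0 <= d, forall k, 0 <= e k,
      forall k, a1 (e k) <= W k <= a2 (e k)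
    & forall k, W k.+1 <= W k - a3 (e k) + s].

(** Choose [r] with [a3 r > s].  Beyond [r] the value [W] decreases, and from
    below [r] it jumps to at most [a2 r + s]; so it never exceeds the maximum of
    this bound and of its initial bound [a2 d]. *)
Lemma dissipates_bounded (s d : R) : 0 <= d -> exists2 K : R, 0 < K &
  forall e W, dissipates s d e W -> forall k, e k <= K.
Proof.
move=> d0.
have [r r0 rs] := class_Koo_unbounded s a3_Koo.
have [K K0 KW] :=
  class_Koo_unbounded (Num.max (a2 d) (a2 r + s)) a1_Koo.
move: KW; rewrite gt_max => /andP[dK rK].
exists K => // e W [e0d epos eW decr] k.
rewrite -(class_K_le a1_Koo.1) ?(ltW K0)//.
apply: (le_trans (andP (eW k)).1).
elim: k => [|k IH].
  apply: (le_trans (andP (eW _)).2).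
  by apply: le_trans (ltW dK); rewrite (class_K_le a2_Koo.1).
apply: le_trans (decr k) _.
have a3e := class_K_ge0 a3_Koo.1 (epos k).
have [er|re] := leP (e k) r.
  have Wr : W k <= a2 r.
    by apply: (le_trans (andP (eW _)).2); rewrite (class_K_le a2_Koo.1)// ltW.
  lra.
have : a3 r <= a3 (e k) by rewrite (class_K_le a3_Koo.1)// ltW.
lra.
Qed.

(** The level [W <= a1 eps] is invariant when [s] is small, and as long as it is
    not reached [W] loses at least [s] per step.  Its initial value is at most
    [a2 d], which bounds the time to reach the level uniformly. *)
Lemma dissipates_eventually_small (d eps : R) : 0 <= d -> 0 < eps ->
  exists2 s : R, 0 < s &
  exists T : nat, forall e W, dissipates s d e W ->
  forall k, (T <= k)%N -> e k <= eps.
Proof.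
move=> d0 eps0; have c0 := class_K_gt0 a1_Koo.1 eps0.
set c := a1 eps in c0.
have [r r0 rc] := class_K_small a2_Koo.1 (divr_gt0 c0 (ltr0Sn _ 1)).
have a3r0 := class_K_gt0 a3_Koo.1 r0.
(* The first term makes the decrease outside the ball of radius [r] at least
   [s]; the second keeps a jump out of that ball, from [W <= a2 r < c / 2],
   below the level [c]. *)
pose s := Num.min (a3 r / 2) (c / 2).
have s0 : 0 < s by rewrite lt_min !divr_gt0.
have s_a3 : s <= a3 r / 2 by rewrite ge_min lexx.
have s_c : s <= c / 2 by rewrite ge_min lexx orbT.
exists s => //; exists (Num.truncn (a2 d / s)).+1 => e W [e0d epos eW decr] k Tk.
rewrite -(class_K_le a1_Koo.1) ?(ltW eps0)//.
apply: (le_trans (andP (eW k)).1); rewrite -/c.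
have large j : c < W j -> W j.+1 <= W j - s.
  move=> cW; have rej : r <= e j.
    rewrite -(class_K_le a2_Koo.1) ?(ltW r0)//.
    apply: le_trans (andP (eW j)).2; lra.
  have : a3 r <= a3 (e j) by rewrite (class_K_le a3_Koo.1)// ltW.
  by have := decr j; lra.
have stays j : W j <= c -> W j.+1 <= c.
  move=> Wc; have [er|re] := leP (e j) r.
    have Wr : W j <= a2 r.
      by apply: (le_trans (andP (eW _)).2); rewrite (class_K_le a2_Koo.1)// ltW.
    have a3e := class_K_ge0 a3_Koo.1 (epos j).
    by have := decr j; lra.
  have : a3 r <= a3 (e j) by rewrite (class_K_le a3_Koo.1)// ltW.
  by have := decr j; lra.
have descent j : W j <= c \/ W j <= a2 d - s *+ j.
  elim: j => [|j [IH|IH]]; [right|left; exact: stays|].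
    rewrite mulr0n subr0; apply: (le_trans (andP (eW _)).2).
    by rewrite (class_K_le a2_Koo.1).
  have [Wc|cW] := leP (W j) c; [left; exact: stays|right].
  by rewrite mulrSr; have := large _ cW; lra.
case: (descent k) => // Wk; exfalso.
have : a2 d < s *+ k.
  rewrite -mulr_natr mulrC -ltr_pdivrMr//.
  have := truncnS_gt (a2 d / s); move/lt_le_trans; apply.
  by rewrite ler_nat.
have a1e := class_K_ge0 a1_Koo.1 (epos k).
case/andP: (eW k) => + _.
lra.
Qed.

End Dissipation.

(** * The monitoring signal *)

Section Monitor.
Context (R : realType) (q : \bar R) (ny : nat) (lambda : R).
Hypothesis lambda_01 : 0 <= lambda < 1.
Implicit Type yt : nat -> 'rV[R]_ny.

Lemma monitorS yt (k : nat) :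
  monitor q lambda yt k.+1 = lambda * monitor q lambda yt k + pnorm q (yt k) ^+ 2.
Proof.
rewrite /monitor big_nat_recr//= subn1 subnn expr0 mul1r mulr_sumr; congr (_ + _).
apply: eq_big_nat => j jk; rewrite mulrA -exprS.
by rewrite (_ : (k - 1 - j).+1 = k - j)%N//; lia.
Qed.

(** The admissible size [d] of the output error is chosen before its bound [B]
    and the time [T0] from which it is that small; only [T] depends on these.
    The signal is the solution of a leaky recursion, hence at most
    [B ^+ 2 / (1 - lambda)], and after [T0] this bound decays geometrically to
    [eps / 2]. *)
Lemma monitor_eventually_small (eps : R) : 0 < eps ->
  exists2 d : R, 0 < d & forall (B : R) (T0 : nat), exists T : nat,
  forall yt, (forall k, pnorm q (yt k) <= B) ->
    (forall k, (T0 <= k)%N -> pnorm q (yt k) <= d) ->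
  forall k, (T <= k)%N -> monitor q lambda yt k <= eps.
Proof.
case/andP: lambda_01 => l0 l1 eps0.
have l1' : 0 < 1 - lambda by rewrite subr_gt0.
pose d := Num.min 1 ((1 - lambda) * (eps / 2)).
have d0 : 0 < d by rewrite lt_min ltr01/= mulr_gt0 ?divr_gt0.
have d2 : d ^+ 2 <= (1 - lambda) * (eps / 2).
  have d1 : d <= 1 by rewrite ge_min lexx.
  apply: (@le_trans _ _ d); last by rewrite ge_min lexx orbT.
  by rewrite expr2 ler_piMr// ltW.
exists d => // B T0; pose M := B ^+ 2 / (1 - lambda).
have lM : lambda * M + B ^+ 2 = M by rewrite /M; field; rewrite gt_eqF.
have lnorm : `|lambda| < 1 by rewrite ger0_norm.
have /cvgrPdist_lt cvM := cvg_geometric M lnorm.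
have [T1 _ T1P] := cvM _ (divr_gt0 eps0 (ltr0Sn _ 1)).
exists (T0 + T1)%N => yt yB yd k Tk.
have mM j : monitor q lambda yt j <= M.
  elim: j => [|j IH].
    by rewrite /monitor big_nil divr_ge0 ?sqr_ge0// ltW.
  rewrite monitorS -lM lerD// ?ler_wpM2l//.
  by rewrite lerXn2r ?nnegrE ?pnorm_ge0// (le_trans _ (yB j))// pnorm_ge0.
have tail m : monitor q lambda yt (T0 + m) <= M * lambda ^+ m + eps / 2.
  elim: m => [|m IH].
    by rewrite addn0 expr0 mulr1 (le_trans (mM _))// lerDl divr_ge0// ltW.
  rewrite addnS monitorS.
  have : pnorm q (yt (T0 + m)%N) ^+ 2 <= d ^+ 2.
    by rewrite lerXn2r ?nnegrE ?pnorm_ge0 ?(ltW d0)// yd// leq_addr.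
  have := ler_wpM2l l0 IH; rewrite [lambda ^+ m.+1]exprS; lra.
have T0k : (T0 <= k)%N by apply: leq_trans Tk; exact: leq_addr.
rewrite -(subnKC T0k); apply: (le_trans (tail _)).
have := T1P (k - T0)%N; rewrite /= leq_subRL// => /(_ Tk).
by rewrite sub0r normrN /geometric/= => /(le_lt_trans (ler_norm _)) /ltW; lra.
Qed.

(** The last [L] output errors have been discounted by a factor of at least
    [lambda ^+ L.-1]; for [lambda = 0] this factor is positive only if
    [L <= 1]. *)
Lemma monitor_ge_window yt (L k : nat) : (L <= k)%N ->
  lambda ^+ L.-1 * \sum_(k - L <= j < k) pnorm q (yt j) ^+ 2
    <= monitor q lambda yt k.
Proof.
case/andP: lambda_01 => l0 l1 Lk.
rewrite mulr_sumr /monitor (big_cat_nat (leq0n (k - L)) (leq_subr L k))/=.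
apply: ler_wpDl.
  by apply: sumr_ge0 => j _; rewrite mulr_ge0 ?sqr_ge0 ?exprn_ge0.
rewrite !big_nat; apply: ler_sum => j /andP[Lj jk].
rewrite ler_wpM2r ?sqr_ge0// ler_wiXn2l ?(ltW l1)//.
by move: Lj jk Lk; rewrite -!subn1; lia.
Qed.

End Monitor.

(** * Sampling, noise levels and upper limits *)

Lemma compact_pnorm_le (R : realType) (q : \bar R) (n : nat) (A : set 'rV[R]_n) :
  (1 <= q)%E -> compact A -> exists2 B : R, 0 < B & forall x, A x -> pnorm q x <= B.
Proof.
move=> q1 /compact_bounded [M [_ AM]].
have M1 : M < `|M| + 1 by rewrite (le_lt_trans (ler_norm M))// ltrDl.
exists (n.+1%:R * (`|M| + 1)); first by rewrite mulr_gt0// ltr_wpDl.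
move=> x Ax; apply: (le_trans (pnorm_le_normr q1 x)).
by rewrite ler_wpM2l//; exact: (AM _ M1).
Qed.

(** Compactness of [D] bounds the distances to the samples; otherwise the
    supremum over [P] would carry no information, being then 0 by convention. *)
Lemma samples_denseP (R : realType) (q : \bar R) (np : nat)
    (P D : set 'rV[R]_np) (phat : forall N : nat, 'I_N -> 'rV[R]_np) :
  (1 <= q)%E -> compact D -> (forall ph p, P ph -> P p -> D (ph - p)) ->
  (forall N (i : 'I_N), P (phat N i)) -> samples_dense q P phat ->
  forall d : R, 0 < d -> exists2 Nstar : nat, (1 <= Nstar)%N &
    forall N, (Nstar <= N)%N -> forall p, P p ->
    exists i : 'I_N, pnorm q (phat N i - p) < d.
Proof.
move=> q1 cD PD phP dense d d0.
have [B B0 DB] := compact_pnorm_le q1 cD.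
have /cvgrPdist_lt dense0 := dense.
have [N0 _ N0P] := dense0 _ d0.
exists N0.+1 => // N N0N p Pp.
have := N0P N (ltnW N0N).
set S := (X in sup X); rewrite sub0r normrN => supd.
have N1 : (0 < N)%N by apply: leq_trans N0N.
pose E (p' : 'rV[R]_np) := [set pnorm q (phat N i - p') | i in [set: 'I_N]].
have E0 p' : E p' !=set0.
  by exists (pnorm q (phat N (Ordinal N1) - p')); exists (Ordinal N1).
have infd : inf (E p) < d.
  apply: le_lt_trans (le_lt_trans (ler_norm _) supd).
  apply: ub_le_sup; last by exists p.
  exists B => _ [p' Pp' <-].
  apply: (@le_trans _ _ (pnorm q (phat N (Ordinal N1) - p'))).
    apply: ge_inf; last by exists (Ordinal N1).
    by exists 0 => _ [i _ <-]; exact: pnorm_ge0.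
  by apply: DB; apply: PD.
by have [_ [i _ <-] id] := inf_lt (E0 p) infd; exists i.
Qed.

Lemma pnorm_le_seq_norm (R : realType) (q : \bar R) (n : nat)
    (x : nat -> 'rV[R]_n) (r : R) :
  (forall k, pball q r (x k)) -> forall k, pnorm q (x k) <= seq_norm q x.
Proof.
move=> xr k; apply: ub_le_sup; last by exists k.
by exists r => _ [j _ <-]; exact: xr.
Qed.

Lemma limn_esup_le_eventually (R : realType) (a : nat -> \bar R) (l : \bar R) (T : nat) :
  (forall k, (T <= k)%N -> (a k <= l)%E) -> (limn_esup a <= l)%E.
Proof.
move=> al; rewrite /limn_esup limf_esupE.
apply: (@le_trans _ _ (ereal_sup (a @` [set k | (T <= k)%N]))).
  apply: ereal_inf_lbound; exists [set k | (T <= k)%N] => //.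
  by exists T.
by apply: ge_ereal_sup => _ [k Tk <-]; exact: al.
Qed.

(** * The error system *)

Section Errors.
Context (R : realType) (q : \bar R) (nx np nu nv nw ny : nat).
Context (P D : set 'rV[R]_np).
Context (f : 'rV[R]_nx -> 'rV[R]_np -> 'rV[R]_nu -> 'rV[R]_nv -> 'rV[R]_nx).
Context (h : 'rV[R]_nx -> 'rV[R]_np -> 'rV[R]_nu -> 'rV[R]_nw -> 'rV[R]_ny).
Context (fhat : 'rV[R]_nx -> 'rV[R]_np -> 'rV[R]_nu -> 'rV[R]_ny -> 'rV[R]_nx).
Hypothesis q_ge1 : (1 <= q)%E.

Lemma observer_sub_state (p ph : 'rV[R]_np) (u : nat -> 'rV[R]_nu)
    (v : nat -> 'rV[R]_nv) (w : nat -> 'rV[R]_nw) (x0 xt0 : 'rV[R]_nx) (k : nat) :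
  let x := state f p u v x0 in
  observer fhat ph u (fun j => h (x j) p (u j) (w j)) (xt0 + x0) k - x k
    = err_state f h fhat (ph - p) p u v w x0 xt0 k.
Proof.
by move=> x; elim: k => [|k IH] /=; [rewrite addrK|rewrite -IH /errF !subrK].
Qed.

Section Disturbance.
Context (sigma : 'rV[R]_np * 'rV[R]_nv * 'rV[R]_nw * 'rV[R]_nx * 'rV[R]_nu -> R).
Hypothesis sigma_cont : {within [set z | D z.1.1.1.1], continuous sigma}.

Lemma disturbance_bounded (dx du dv dw : R) : compact D ->
  exists s : R, forall pt v w x u, D pt -> pball q dv v -> pball q dw w ->
    pball q dx x -> pball q du u -> sigma (pt, v, w, x, u) <= s.
Proof.
move=> cD.
pose K := D `*` [set v : 'rV[R]_nv | `|v| <= dv] `*` [set w : 'rV[R]_nw | `|w| <= dw]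
  `*` [set x : 'rV[R]_nx | `|x| <= dx] `*` [set u : 'rV[R]_nu | `|u| <= du].
have cK : compact K by do 4?apply: compact_setX => //; exact: compact_normr_le.
have Ksub : K `<=` [set z | D z.1.1.1.1] by move=> z [[[[]]]].
have [M [_ sM]] := compact_bounded
  (continuous_compact (continuous_subspaceW Ksub sigma_cont) cK).
exists (`|M| + 1) => pt v w x u Dpt vb wb xb ub.
apply: (le_trans (ler_norm _)).
apply: (sM (`|M| + 1)); first by rewrite (le_lt_trans (ler_norm M))// ltrDl.
exists (pt, v, w, x, u) => //.
by do 4?split => //=; apply: le_trans (normr_le_pnorm q_ge1 _) _.
Qed.

(** The values of [sigma] are compared with those at points
    [(0, 0, 0, x, u)], which form a compact set when [x] and [u] are bounded. *)
Lemma disturbance_small (dx du : R) : D 0 ->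
  (forall x u, sigma (0, 0, 0, x, u) = 0) -> forall s : R, 0 < s ->
  exists2 d : R, 0 < d & forall pt v w x u, D pt ->
    pball q d pt -> pball q d v -> pball q d w ->
    pball q dx x -> pball q du u -> sigma (pt, v, w, x, u) <= s.
Proof.
move=> D0 sigma0 s s0.
pose K := [set 0 : 'rV[R]_np] `*` [set 0 : 'rV[R]_nv] `*` [set 0 : 'rV[R]_nw]
  `*` [set x : 'rV[R]_nx | `|x| <= dx] `*` [set u : 'rV[R]_nu | `|u| <= du].
have cK : compact K.
  by do 4?apply: compact_setX => //; try exact: compact_normr_le; exact: compact_set1.
have Ksub : K `<=` [set z | D z.1.1.1.1] by move=> z [[[[/= ->]]]].
have [d d0 dP] := uniform_near_compact cK Ksub sigma_cont s0.
have d20 : 0 < d / 2 by rewrite divr_gt0.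
exists (d / 2) => // pt v w x u Dpt ptd vd wd xb ub.
have ball0 n (z : 'rV[R]_n) : pball q (d / 2) z -> ball 0 d z.
  move=> zd; rewrite -ball_normE /= sub0r normrN.
  by apply: (le_lt_trans (le_trans (normr_le_pnorm q_ge1 z) zd)); lra.
have : ball (sigma (0, 0, 0, x, u)) s (sigma (pt, v, w, x, u)).
  apply: dP => //.
    by do 4?split => //=; apply: le_trans (normr_le_pnorm q_ge1 _) _.
  by do 4?apply: ball_pair; first [exact: ball0 | exact: ballxx].
rewrite -ball_normE /= sigma0 sub0r normrN => /ltW.
exact: (le_trans (ler_norm _)).
Qed.

End Disturbance.

Section Output.
Hypothesis P_compact : compact P.
Hypothesis h_lip : locally_lipschitz_output P h.

Let hz (z : 'rV[R]_nx * 'rV[R]_np * 'rV[R]_nu * 'rV[R]_nw) :=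
  h z.1.1.1 z.1.1.2 z.1.2 z.2.

Let hz_cont : {within [set z | P z.1.1.2], continuous hz}.
Proof. exact: lipschitz_within_continuous h_lip. Qed.

(** The two outputs in the error are values of [h] on one compact set, on which
    the measurement noise may also be 0. *)
Lemma output_error_bounded (dxt dx du dw : R) :
  exists B : R, forall xt x p ph u w, P p -> P ph ->
    pball q dxt xt -> pball q dx x -> pball q du u -> pball q dw w ->
    pnorm q (errH h xt x (ph - p) p u w) <= B.
Proof.
pose K := [set x : 'rV[R]_nx | `|x| <= `|dxt| + `|dx|] `*` P
  `*` [set u : 'rV[R]_nu | `|u| <= du] `*` [set w : 'rV[R]_nw | `|w| <= `|dw|].
have cK : compact K by do 3?apply: compact_setX => //; exact: compact_normr_le.
have Ksub : K `<=` [set z | P z.1.1.2] by move=> z [[[]]].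
have [M [_ hM]] := compact_bounded
  (continuous_compact (continuous_subspaceW Ksub hz_cont) cK).
have M1 : M < `|M| + 1 by rewrite (le_lt_trans (ler_norm M))// ltrDl.
have {}hM z : K z -> `|hz z| <= `|M| + 1.
  by move=> Kz; apply: (hM (`|M| + 1)) => //; exists z.
exists (ny.+1%:R * (`|M| + 1 + (`|M| + 1))) => xt x p ph u w Pp Pph xtb xb ub wb.
apply: (le_trans (pnorm_le_normr q_ge1 _)); rewrite ler_wpM2l// /errH subrK.
have nb n (z : 'rV[R]_n) r : pball q r z -> `|z| <= `|r|.
  move=> zr; apply: le_trans (le_trans (normr_le_pnorm q_ge1 z) zr) _.
  exact: ler_norm.
have nb' n (z : 'rV[R]_n) r : pball q r z -> `|z| <= r.
  by move=> zr; apply: le_trans (normr_le_pnorm q_ge1 z) zr.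
apply: (le_trans (ler_normB _ _)); apply: lerD.
  apply: (hM (xt + x, ph, u, 0)); do 3?split => //=; last 2 first.
  - exact: nb'.
  - by rewrite normr0.
  by apply: (le_trans (ler_normD _ _)); apply: lerD; exact: nb.
apply: (hM (x, p, u, w)); do 3?split => //=; [|exact: nb'|exact: nb].
by apply: le_trans (nb _ _ _ xb) _; rewrite lerDr.
Qed.

(** Both outputs are close to the noise-free output [h x p u 0] at the true
    state and parameter, which ranges over a compact set. *)
Lemma output_error_small (dx du : R) (eps : R) : 0 < eps ->
  exists2 d : R, 0 < d & forall xt x p ph u w, P p -> P ph ->
    pball q d xt -> pball q d (ph - p) -> pball q d w ->
    pball q dx x -> pball q du u ->
    pnorm q (errH h xt x (ph - p) p u w) <= eps.
Proof.
move=> eps0.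
pose K := [set x : 'rV[R]_nx | `|x| <= dx] `*` P
  `*` [set u : 'rV[R]_nu | `|u| <= du] `*` [set 0 : 'rV[R]_nw].
have cK : compact K.
  by do 3?apply: compact_setX => //; try exact: compact_normr_le; exact: compact_set1.
have Ksub : K `<=` [set z | P z.1.1.2] by move=> z [[[]]].
have e20 : 0 < eps / ny.+1%:R / 2 by rewrite !divr_gt0.
have [d d0 dP] := uniform_near_compact cK Ksub hz_cont e20.
have d20 : 0 < d / 2 by rewrite divr_gt0.
exists (d / 2) => // xt x p ph u w Pp Pph xtd ptd wd xb ub.
have nb n (z : 'rV[R]_n) : pball q (d / 2) z -> `|z| < d.
  by move=> zd; apply: (le_lt_trans (le_trans (normr_le_pnorm q_ge1 z) zd)); lra.
have Kz : K (x, p, u, 0).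
  by do 3?split => //=; apply: le_trans (normr_le_pnorm q_ge1 _) _.
have h1 : ball (hz (x, p, u, 0)) (eps / ny.+1%:R / 2) (hz (xt + x, ph, u, 0)).
  apply: dP => //; do 3?apply: ball_pair; rewrite -?ball_normE /=.
  - by rewrite opprD addrC subrK normrN; exact: nb.
  - by rewrite distrC; exact: nb.
  - by rewrite subrr normr0.
  - by rewrite subrr normr0.
have h2 : ball (hz (x, p, u, 0)) (eps / ny.+1%:R / 2) (hz (x, p, u, w)).
  apply: dP => //; do 3?apply: ball_pair; rewrite -?ball_normE /= ?subrr ?normr0//.
  by rewrite sub0r normrN; exact: nb.
have := ball_splitr h1 h2.
rewrite -ball_normE /= => /ltW; rewrite ler_pdivlMr// mulrC /errH subrK.
exact: le_trans (pnorm_le_normr q_ge1 _).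
Qed.

End Output.

Section Convergence.
Context (dxt dx du dv dw : R).

Definition admissible (p ph : 'rV[R]_np) (x0 xt0 : 'rV[R]_nx)
    (u : nat -> 'rV[R]_nu) (v : nat -> 'rV[R]_nv) (w : nat -> 'rV[R]_nw) : Prop :=
  [/\ P p, P ph, pball q dxt xt0, pball q dx x0
    & [/\ forall k, pball q du (u k), forall k, pball q dv (v k)
        & forall k, pball q dw (w k)]].

(** The regime in which the estimates involve no noise gain. *)
Definition quiet (d : R) (pt : 'rV[R]_np) (v : nat -> 'rV[R]_nv)
    (w : nat -> 'rV[R]_nw) : Prop :=
  [/\ pball q d pt, forall k, pball q d (v k) & forall k, pball q d (w k)].

Hypotheses (dxt_ge0 : 0 <= dxt) (dx_ge0 : 0 <= dx) (du_ge0 : 0 <= du)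
  (dv_ge0 : 0 <= dv) (dw_ge0 : 0 <= dw).
Hypothesis P_compact : compact P.
Hypothesis D_compact : compact D.
Hypothesis P_sub_D : forall ph p, P ph -> P p -> D (ph - p).
Hypothesis h_lip : locally_lipschitz_output P h.
Hypothesis states_bounded : bounded_states q nw P f.
Hypothesis observer_robust : robust_observer q P D f h fhat.

(** Along a trajectory the disturbance is bounded, by compactness of [D] and
    because the states, inputs and noises stay in balls. *)
Lemma error_bounded : exists2 K : R, 0 < K &
  forall p ph x0 xt0 u v w, admissible p ph x0 xt0 u v w ->
  forall k, pball q K (err_state f h fhat (ph - p) p u v w x0 xt0 k).
Proof.
have [Kx Kx0 xK] := states_bounded dx_ge0 du_ge0 dv_ge0 dw_ge0.
have [a1 [a2 [a3 [sigma [V [[a1K a2K a3K] [[sc _ _] [_ _ VW Vdec]]]]]]]] := observer_robust.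
have [s sP] := disturbance_bounded sc Kx du dv dw D_compact.
have [K K0 KP] := dissipates_bounded a1K a2K a3K s dxt_ge0.
exists K => // p ph x0 xt0 u v w [Pp Pph xt0b x0b [ub vb wb]].
pose e := err_state f h fhat (ph - p) p u v w x0 xt0.
apply: (KP (fun k => pnorm q (e k)) (fun k => V ph (e k))); split => // k.
- exact: pnorm_ge0.
- exact: VW.
apply: (le_trans (Vdec _ _ _ _ _ _ _ Pp Pph)); rewrite lerD2l.
by apply: sP => //; [exact: P_sub_D|exact: xK].
Qed.

Lemma error_eventually_small (eps : R) : D 0 -> 0 < eps ->
  exists2 d : R, 0 < d & exists T : nat,
  forall p ph x0 xt0 u v w, admissible p ph x0 xt0 u v w ->
    quiet d (ph - p) v w ->
  forall k, (T <= k)%N ->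
    pball q eps (err_state f h fhat (ph - p) p u v w x0 xt0 k).
Proof.
move=> D0 eps0.
have [Kx Kx0 xK] := states_bounded dx_ge0 du_ge0 dv_ge0 dw_ge0.
have [a1 [a2 [a3 [sigma [V [[a1K a2K a3K] [[sc _ s00] [_ _ VW Vdec]]]]]]]] := observer_robust.
have [s s0 [T TP]] := dissipates_eventually_small a1K a2K a3K dxt_ge0 eps0.
have [d d0 sP] := disturbance_small sc Kx du D0 s00 s0.
exists d => //; exists T.
move=> p ph x0 xt0 u v w [Pp Pph xt0b x0b [ub vb wb]] [ptd vd wd].
pose e := err_state f h fhat (ph - p) p u v w x0 xt0.
apply: (TP (fun k => pnorm q (e k)) (fun k => V ph (e k))); split => // k.
- exact: pnorm_ge0.
- exact: VW.
apply: (le_trans (Vdec _ _ _ _ _ _ _ Pp Pph)); rewrite lerD2l.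
by apply: sP => //; [exact: P_sub_D|apply: xK].
Qed.

(** The levels are chosen backwards from [eps]: [dy] for the output error, then
    [d1] for the state error, then [d2] for the parameter error and the noises.
    The a priori bound [B] on the output error during the transient enters only
    the time [T]. *)
Lemma monitor_quiet_small (lambda eps : R) :
  D 0 -> 0 <= lambda < 1 -> 0 < eps ->
  exists2 d : R, 0 < d & exists T : nat,
  forall p ph x0 xt0 u v w, admissible p ph x0 xt0 u v w ->
    quiet d (ph - p) v w ->
  forall k, (T <= k)%N ->
    monitor q lambda (err_output f h fhat (ph - p) p u v w x0 xt0) k <= eps.
Proof.
move=> D0 l01 eps0.
have [Kx Kx0 xK] := states_bounded dx_ge0 du_ge0 dv_ge0 dw_ge0.
have [Kxt Kxt0 xtK] := error_bounded.
have [B BP] := output_error_bounded P_compact h_lip Kxt Kx du dw.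
have [dy dy0 dyP] := monitor_eventually_small q ny l01 eps0.
have [d1 d10 d1P] := output_error_small P_compact h_lip Kx du dy0.
have [d2 d20 [T0 d2P]] := error_eventually_small D0 d10.
have [T TP] := dyP B T0.
exists (Num.min d1 d2); first by rewrite lt_min d10.
exists T => p ph x0 xt0 u v w adm [ptd vd wd].
have [Pp Pph xt0b x0b [ub vb wb]] := adm.
have xb k := xK p x0 u v w Pp x0b ub vb wb k.
have le1 n (z : 'rV[R]_n) : pball q (Num.min d1 d2) z -> pball q d1 z.
  by rewrite /pball/= le_min => /andP[].
have le2 n (z : 'rV[R]_n) : pball q (Num.min d1 d2) z -> pball q d2 z.
  by rewrite /pball/= le_min => /andP[].
apply: TP => k => [|T0k].
  by apply: BP => //; apply: xtK.
apply: d1P => //; [apply: d2P => // | exact: le1 | exact: le1].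
by split=> [|j|j]; exact: le2.
Qed.

End Convergence.

End Errors.

(** * Selection of an observer *)

(** The excitation window is a lower bound on the signal of the selected
    observer, which is at most the signal of any other one; cancelling the
    discount factor leaves a comparison of two values of [al]. *)
Lemma selected_parameter_le (R : realType) (q : \bar R) (np ny N : nat)
    (lambda : R) (al : R -> R) (L : nat) (pt : 'I_N -> 'rV[R]_np)
    (yt : 'I_N -> nat -> 'rV[R]_ny) (sel : nat -> 'I_N) (r : R) (i : 'I_N) (k : nat) :
  0 <= lambda < 1 -> 0 < lambda ^+ L.-1 -> class_K al -> 0 <= r ->
  excited q al L pt yt -> is_selection q lambda yt sel -> (L <= k)%N ->
  monitor q lambda (yt i) k <= lambda ^+ L.-1 * al r ->
  pnorm q (pt (sel k)) <= r.
Proof.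
move=> l01 lL alK r0 exc sel_min Lk mon_i.
rewrite -(class_K_le alK) ?pnorm_ge0// -(ler_pM2l lL).
apply: (le_trans _ (le_trans (sel_min k i) mon_i)).
apply: (le_trans _ (monitor_ge_window q l01 (yt (sel k)) Lk)).
by rewrite ler_pM2l//; exact: exc.
Qed.

Theorem theorem1 (R : realType) (q : \bar R) (nx np nu nv nw ny : nat)
    (P D : set 'rV[R]_np)
    (f : 'rV[R]_nx -> 'rV[R]_np -> 'rV[R]_nu -> 'rV[R]_nv -> 'rV[R]_nx)
    (h : 'rV[R]_nx -> 'rV[R]_np -> 'rV[R]_nu -> 'rV[R]_nw -> 'rV[R]_ny)
    (fhat : 'rV[R]_nx -> 'rV[R]_np -> 'rV[R]_nu -> 'rV[R]_ny -> 'rV[R]_nx)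
    (phat : forall N : nat, 'I_N -> 'rV[R]_np) (lambda : R)
    (al : R -> R -> R -> R -> R -> R -> R)
    (Npe : R -> R -> R -> R -> R -> nat)
    (q_ge1 : (1 <= q)%E)
    (P_compact : compact P)
    (D_compact : compact D)
    (P_sub_D : forall ph p, P ph -> P p -> D (ph - p))
    (h_lip : locally_lipschitz_output P h)
    (phat_P : forall N (i : 'I_N), P (phat N i))
    (phat_dense : samples_dense q P phat)
    (lambda_01 : 0 <= lambda < 1)
    (A3 : bounded_states q nw P f)
    (A4 : robust_observer q P D f h fhat)
    (A5 : persistently_exciting q P D f h fhat al Npe)
    (dxt dx du dv dw : R) (dxt_ge0 : 0 <= dxt) (dx_ge0 : 0 <= dx)
    (du_ge0 : 0 <= du) (dv_ge0 : 0 <= dv) (dw_ge0 : 0 <= dw)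
    (memory : lambda = 0 -> Npe dxt dx du dv dw = 1%N)
    (nup nux : R) (nup_gt0 : 0 < nup) (nux_gt0 : 0 < nux) :
  exists (ups_p ups_x om_p om_x : R -> R) (Kxt : R) (Nstar M : nat),
    [/\ class_Koo ups_p, class_Koo ups_x, class_Koo om_p & class_Koo om_x] /\
    [/\ 0 < Kxt, (1 <= Nstar)%N & (1 <= M)%N] /\
    forall N : nat, (Nstar <= N)%N ->
    forall (xt0 : 'I_N -> 'rV[R]_nx) (p : 'rV[R]_np) (x0 : 'rV[R]_nx)
           (v : nat -> 'rV[R]_nv) (w : nat -> 'rV[R]_nw),
      (forall i, pball q dxt (xt0 i)) -> P p -> pball q dx x0 ->
      (forall k, pball q dv (v k)) -> (forall k, pball q dw (w k)) ->
    exists u : nat -> 'rV[R]_nu,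
      (forall k, pball q du (u k)) /\
      let x := state f p u v x0 in
      let y := fun k => h (x k) p (u k) (w k) in
      let xh := fun i => observer fhat (phat N i) u y (xt0 i + x0) in
      let yh := fun i k => h (xh i k) (phat N i) (u k) 0 in
      let xt := fun i k => xh i k - x k in
      let yt := fun i k => yh i k - y k in
      let pt := fun i => phat N i - p in
      excited q (al dxt dx du dv dw) (Npe dxt dx du dv dw) pt yt /\
      (forall i k, pball q Kxt (xt i k)) /\
      forall sel : nat -> 'I_N, is_selection q lambda yt sel ->
        (forall k, (M <= k)%N ->
           pnorm q (pt (sel k)) <= nup + ups_p (seq_norm q v) + om_p (seq_norm q w)) /\
        (limn_esup (fun k => (pnorm q (xt (sel k) k))%:E)
           <= (nux + ups_x (seq_norm q v) + om_x (seq_norm q w))%:E)%E.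
Proof.
(* A point of [P] puts [0] in [D]; without one there is no trajectory. *)
have [[p0 Pp0]|P0] := pselect (exists p, P p); last first.
  exists (fun s => 1 * s), (fun s => 1 * s), (fun s => 1 * s), (fun s => 1 * s).
  exists 1, 1%N, 1%N.
  do 2!split => //; try exact: class_Koo_linear.
  by move=> N _ xt0 p x0 v w _ Pp; case: P0; exists p.
have D0 : D 0 by rewrite -(subrr p0); exact: P_sub_D.
have [alK L1 exciting] := A5 _ _ _ _ _ dxt_ge0 dx_ge0 du_ge0 dv_ge0 dw_ge0.
set L := Npe dxt dx du dv dw in memory L1 exciting *.
set al0 := al dxt dx du dv dw in alK exciting *.
have lL : 0 < lambda ^+ L.-1.
  have [l0|l0] := eqVneq lambda 0; first by rewrite (memory l0) expr0.
  by rewrite exprn_gt0// lt_neqAle eq_sym l0; case/andP: lambda_01.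
have [Dmax Dmax0 DP] := compact_pnorm_le q_ge1 D_compact.
have [Kxt Kxt0 KP] :=
  error_bounded q_ge1 dxt_ge0 dx_ge0 du_ge0 dv_ge0 dw_ge0 D_compact P_sub_D A3 A4.
have [d1 d10 [T1 xsmall]] := error_eventually_small
  q_ge1 dxt_ge0 dx_ge0 du_ge0 dv_ge0 dw_ge0 P_sub_D A3 A4 D0 nux_gt0.
(* Below [d1] a parameter error makes the state error obey its margin in the end,
   so the selected parameter error is also brought below [d1]. *)
pose r := Num.min nup d1.
have r0 : 0 < r by rewrite lt_min nup_gt0.
have eps0 : 0 < lambda ^+ L.-1 * al0 r.
  by rewrite mulr_gt0//; apply: class_K_gt0 r0; case: alK.
have [d2 d20 [T2 ysmall]] := monitor_quiet_small q_ge1 dxt_ge0 dx_ge0 du_ge0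
  dv_ge0 dw_ge0 P_compact D_compact P_sub_D h_lip A3 A4 D0 lambda_01 eps0.
have [Nstar Nstar1 dense] :=
  samples_denseP q_ge1 D_compact P_sub_D phat_P phat_dense d20.
pose d := Num.min d1 d2.
have d0 : 0 < d by rewrite lt_min d10.
pose c := (Dmax + Kxt) / d.
have c0 : 0 < c by rewrite divr_gt0// addr_gt0.
exists (fun s => c * s), (fun s => c * s), (fun s => c * s), (fun s => c * s).
exists Kxt, Nstar, (maxn L T2).
split; first by split; exact: class_Koo_linear.
split; first by split=> //; rewrite leq_max L1.
move=> N NN xt0 p x0 v w xt0b Pp x0b vb wb.
have N1 : (1 <= N)%N by exact: leq_trans NN.
have ptD i : D (phat N i - p) /\ P (phat N i - p + p).
  by split; [exact: P_sub_D|rewrite subrK].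
have [u ub exc] := exciting N _ xt0 p x0 v w N1 Pp ptD xt0b x0b vb wb.
exists u; split=> // x y xh yh xt yt pt.
have xtE i : xt i = err_state f h fhat (pt i) p u v w x0 (xt0 i).
  by apply/funext => k; exact: observer_sub_state.
have ytE : yt = fun i => err_output f h fhat (pt i) p u v w x0 (xt0 i).
  apply/funext => i; apply/funext => k.
  by rewrite /err_output -xtE /errH /xt /pt !subrK.
rewrite ytE; split=> //.
have adm i : admissible q P dxt dx du dv dw p (phat N i) x0 (xt0 i) u v w by [].
have xtK i k : pball q Kxt (xt i k) by rewrite xtE; exact: KP.
split=> // sel sel_min.
have gain_ge0 n (z : nat -> 'rV[R]_n) b : (forall k, pball q b (z k)) ->
    0 <= c * seq_norm q z.
  move=> zb; rewrite mulr_ge0 ?(ltW c0)//.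
  exact: le_trans (pnorm_ge0 q (z 0%N)) (pnorm_le_seq_norm zb 0%N).
have cv := gain_ge0 _ v dv vb; have cw := gain_ge0 _ w dw wb.
have [/andP[vd wd]|loud] :=
  boolP ((seq_norm q v <= d) && (seq_norm q w <= d)); last first.
  (* One noise exceeds [d]: the gains dominate the a priori bounds. *)
  have large : Dmax + Kxt <= c * seq_norm q v + c * seq_norm q w.
    have big s : d < s -> Dmax + Kxt <= c * s.
      by move=> ds; rewrite /c mulrAC ler_pdivlMr// ler_pM2l ?addr_gt0// ltW.
    move: loud; rewrite negb_and -!ltNge => /orP[/big|/big]; lra.
  split=> [k _|].
    by apply: le_trans (DP _ (ptD _).1) _; lra.
  apply: (@limn_esup_le_eventually _ _ _ 0) => k _; rewrite lee_fin.
  by apply: le_trans (xtK _ _) _; lra.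
have quietW e i : d <= e -> pball q e (pt i) -> quiet q e (pt i) v w.
  move=> de pte; split=> // k; rewrite /pball/=.
    exact: le_trans (pnorm_le_seq_norm vb k) (le_trans vd de).
  exact: le_trans (pnorm_le_seq_norm wb k) (le_trans wd de).
have dd1 : d <= d1 by rewrite ge_min lexx.
have dd2 : d <= d2 by rewrite ge_min lexx orbT.
have [i0 /ltW i0d] := dense N NN p Pp.
have ptr k : (maxn L T2 <= k)%N -> pnorm q (pt (sel k)) <= r.
  rewrite geq_max => /andP[Lk T2k].
  apply: (selected_parameter_le (i := i0) lambda_01 lL alK.1 (ltW r0) exc sel_min Lk).
  exact: ysmall (adm i0) (quietW _ _ dd2 i0d) _ T2k.
split=> [k Mk|].
  apply: (le_trans (ptr k Mk)); have : r <= nup by rewrite ge_min lexx.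
  lra.
apply: (@limn_esup_le_eventually _ _ _ (maxn T1 (maxn L T2))) => k.
rewrite geq_max => /andP[T1k Mk]; rewrite lee_fin.
have rd1 : r <= d1 by rewrite ge_min lexx orbT.
have := xsmall _ _ _ _ _ _ _ (adm (sel k))
  (quietW _ _ dd1 (le_trans (ptr k Mk) rd1)) k T1k.
rewrite -xtE /pball/=; lra.
Qed.
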